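(* Let $\Sigma=(G,\sigma)$ be a signed graph whose underlying graph $G$ is finite, simple, connected and bipartite. Then $\Sigma$ is distance-compatible if and only if it is balanced.
   Context: A signed graph $\Sigma=(G,\sigma)$ consists of an underlying graph $G=(V,E)$ and a signature $\sigma:E\to\{1,-1\}$. The sign of a path or cycle is the product of the signs of its edges. $\Sigma$ is balanced if every cycle of $\Sigma$ has sign $+1$. Let $d(u,v)$ be the usual graph distance in $G$. For vertices $u,v$, let $\sigma_{\max}(u,v)=-1$ if all shortest $uv$-paths have sign $-1$, and $+1$ otherwise; let $\sigma_{\min}(u,v)=+1$ if all shortest $uv$-paths have sign $+1$, and $-1$ otherwise. Put $d_{\max}(u,v)=\sigma_{\max}(u,v)d(u,v)$ and $d_{\min}(u,v)=\sigma_{\min}(u,v)d(u,v)$. Two vertices $u,v$ are distance-compatible if $d_{\min}(u,v)=d_{\max}(u,v)$, and $\Sigma$ is distance-compatible if every two of its vertices are distance-compatible (equivalently, for every two vertices all shortest paths between them have the same sign). *)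

(* Defs.v *)
From mathcomp Require Import all_boot all_order all_algebra.

Set Implicit Arguments.
Unset Strict Implicit.
Unset Printing Implicit Defensive.

Import Order.TTheory GRing.Theory Num.Theory.
Local Open Scope ring_scope.

Record simple_graph (V : finType) := SimpleGraph {
  adj : rel V;
  adj_sym : symmetric adj;
  adj_irrefl : irreflexive adj
}.

(* The signature is a function of unordered edges: it is symmetric and
   {1,-1}-valued on adjacent pairs; its values elsewhere are irrelevant. *)
Record signed_graph (V : finType) := SignedGraph {
  underlying :> simple_graph V;
  sgn : V -> V -> int;
  sgn_sym : forall u v, adj underlying u v -> sgn u v = sgn v u;
  sgn_pm1 : forall u v, adj underlying u v -> sgn u v = 1 \/ sgn u v = -1
}.

Definition connected_graph (V : finType) (G : simple_graph V) : Prop :=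
  forall u v : V, connect (adj G) u v.

Definition bipartite (V : finType) (G : simple_graph V) : Prop :=
  exists A : {set V}, forall u v : V, adj G u v -> (u \in A) != (v \in A).

(* As in [path.v], a path u = x_0, x_1, ..., x_k = v is given by its start u
   and the list p = [:: x_1; ...; x_k], so its length is [size p]. *)
Definition uv_path (V : finType) (G : simple_graph V) (u v : V) (p : seq V) :
  bool := [&& path (adj G) u p, last u p == v & uniq (u :: p)].

(* Paths have fewer than #|V| edges; the value is #|V| if there is no uv-path. *)
Definition dist (V : finType) (G : simple_graph V) (u v : V) : nat :=
  \big[minn/#|V|]_(k < #|V| | [exists p : k.-tuple V, uv_path G u v p]) k.

Definition path_sign (V : finType) (S : signed_graph V) (u : V) (p : seq V) :
  int := \prod_(s <- pairmap (sgn S) u p) s.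

Definition sigma_max (V : finType) (S : signed_graph V) (u v : V) : int :=
  if [forall p : (dist S u v).-tuple V, uv_path S u v p ==>
        (path_sign S u p == -1)]
  then -1 else 1.

Definition sigma_min (V : finType) (S : signed_graph V) (u v : V) : int :=
  if [forall p : (dist S u v).-tuple V, uv_path S u v p ==>
        (path_sign S u p == 1)]
  then 1 else -1.

Definition d_max (V : finType) (S : signed_graph V) (u v : V) : int :=
  sigma_max S u v * (dist S u v)%:Z.

Definition d_min (V : finType) (S : signed_graph V) (u v : V) : int :=
  sigma_min S u v * (dist S u v)%:Z.

Definition vertices_compatible (V : finType) (S : signed_graph V) (u v : V) :
  Prop := d_min S u v = d_max S u v.

Definition distance_compatible (V : finType) (S : signed_graph V) : Prop :=
  forall u v : V, vertices_compatible S u v.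

(* The size condition excludes the empty list and [:: u; v] along a single
   edge, which [cycle] from [path.v] accepts. *)
Definition graph_cycle (V : finType) (G : simple_graph V) (c : seq V) : bool :=
  [&& (3 <= size c)%N, cycle (adj G) c & uniq c].

Definition cycle_sign (V : finType) (S : signed_graph V) (c : seq V) : int :=
  if c is x :: p then path_sign S x (rcons p x) else 1.

Definition balanced (V : finType) (S : signed_graph V) : Prop :=
  forall c : seq V, graph_cycle S c -> cycle_sign S c = 1.

(* Main.v *)
Require Import Defs.
From mathcomp Require Import all_boot all_order all_algebra.

(** Both properties say that signs are determined by endpoints: the signs of all
    walks for balance, only those of shortest paths for compatibility.

    If [S] is balanced, then every closed walk is positive, because a closed
    walk with a repeated vertex splits into two shorter ones
    ([balanced_closed_walk]).  Two geodesics from [u] to [v] form a closed walk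
    when the second is reversed, so they have the same sign.

    Conversely, assume compatibility and fix a root [r].  All geodesics from
    [r] to [v] have the same sign, namely [sigma_max S r v]; this is a potential
    (a switching function) [f] with [sgn u v = f u * f v] on every edge.
    Indeed, in a bipartite graph the ends of an edge are at distances from [r] of
    different parity, so one end is strictly farther and is reached by a
    geodesic through the other ([sgn_potential]).  The sign of a walk then
    telescopes to the product of [f] at its two ends, which is 1 when it is
    closed. *)

Set Implicit Arguments.
Unset Strict Implicit.
Unset Printing Implicit Defensive.

Import Order.TTheory GRing.Theory Num.Theory.
Local Open Scope ring_scope.

(** * Distances and geodesics *)

(** Stated for walks, so that extending a geodesic by an edge calls only for a
    length count; minimality makes the vertices distinct ([geodesic_uv_path]). *)
Definition geodesic (V : finType) (G : simple_graph V) (u v : V) (p : seq V) :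
  bool := [&& path (adj G) u p, last u p == v & size p == dist G u v].

Lemma uv_path_size (V : finType) (G : simple_graph V) (u v : V) (p : seq V) :
  uv_path G u v p -> (size p < #|V|)%N.
Proof. by case/and3P=> _ _ /card_uniqP /= <-; apply: max_card. Qed.

Lemma dist_le_uv_path (V : finType) (G : simple_graph V) (u v : V) (p : seq V) :
  uv_path G u v p -> (dist G u v <= size p)%N.
Proof.
move=> pP; have lt_p := uv_path_size pP.
rewrite /dist -minEnat -leEnat.
apply: (@bigmin_inf _ _ _ _ (Ordinal lt_p)) => //.
by apply/existsP; exists (in_tuple p).
Qed.

Lemma dist_le_walk (V : finType) (G : simple_graph V) (u : V) (p : seq V) :
  path (adj G) u p -> (dist G u (last u p) <= size p)%N.
Proof.
move=> /shortenP[q qP uq sub_qp].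
apply: (@leq_trans (size q)); last first.
  by case/andP: uq => _ /uniq_leq_size; apply.
by apply: dist_le_uv_path; apply/and3P; split.
Qed.

(** Removing the loops of a walk with a repeated vertex would leave a path
    shorter than the distance. *)
Lemma geodesic_uv_path (V : finType) (G : simple_graph V) (u v : V)
    (p : seq V) : geodesic G u v p -> uv_path G u v p.
Proof.
case/and3P=> pP /eqP <- /eqP sp; apply/and3P; split=> //.
case/shortenP: {+}pP sp => q qP uq sub_qp sp.
apply: (leq_size_uniq uq) => [x|].
  by rewrite !inE => /orP[->//|/sub_qp ->]; rewrite orbT.
by rewrite /= sp ltnS dist_le_uv_path //; apply/and3P; split.
Qed.

Lemma connect_geodesic (V : finType) (G : simple_graph V) (u v : V) :
  connect (adj G) u v -> exists p, geodesic G u v p.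
Proof.
case/connectP=> p0 /shortenP[q qP uq _] vE.
have qG : uv_path G u v q by rewrite /uv_path qP vE eqxx.
(* Paths are shorter than the default value [#|V|] of the minimum in [dist], so
   that minimum is attained by some path. *)
have lt_dist : (dist G u v < #|V|)%N.
  exact: leq_ltn_trans (dist_le_uv_path qG) (uv_path_size qG).
have : dist G u v = #|V| \/ exists p, uv_path G u v p /\ size p = dist G u v.
  rewrite /dist; elim/big_ind: _ => [|m n Hm Hn|k /existsP[p pP]]; first by left.
    by case: (leqP m n) => _.
  by right; exists p; rewrite size_tuple.
case=> [dE|[p [/and3P[pP pv _] sp]]]; first by rewrite dE ltnn in lt_dist.
by exists p; rewrite /geodesic pP pv sp eqxx.
Qed.

(** * Signs of walks *)

Lemma path_sign_nil (V : finType) (S : signed_graph V) (u : V) :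
  path_sign S u [::] = 1.
Proof. by rewrite /path_sign big_nil. Qed.

Lemma path_sign_cons (V : finType) (S : signed_graph V) (u v : V) (p : seq V) :
  path_sign S u (v :: p) = sgn S u v * path_sign S v p.
Proof. by rewrite /path_sign /= big_cons. Qed.

Lemma path_sign_cat (V : finType) (S : signed_graph V) (u : V) (p q : seq V) :
  path_sign S u (p ++ q) = path_sign S u p * path_sign S (last u p) q.
Proof. by rewrite /path_sign pairmap_cat big_cat. Qed.

Lemma path_sign_rcons (V : finType) (S : signed_graph V) (u v : V)
    (p : seq V) :
  path_sign S u (rcons p v) = path_sign S u p * sgn S (last u p) v.
Proof. by rewrite -cats1 path_sign_cat path_sign_cons path_sign_nil mulr1. Qed.

Lemma sgn_sq (V : finType) (S : signed_graph V) (u v : V) :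
  adj S u v -> sgn S u v * sgn S u v = 1.
Proof. by case/(sgn_pm1 (s := S)) => ->. Qed.

Lemma path_sign_sq (V : finType) (S : signed_graph V) (u : V) (p : seq V) :
  path (adj S) u p -> path_sign S u p * path_sign S u p = 1.
Proof.
elim: p u => [|v p IHp] u /=; first by rewrite path_sign_nil.
by case/andP=> uv /IHp pp; rewrite path_sign_cons mulrACA sgn_sq // pp.
Qed.

Lemma last_rev_belast (T : Type) (u : T) (p : seq T) :
  last (last u p) (rev (belast u p)) = u.
Proof. by case: p => //= v p; rewrite rev_cons last_rcons. Qed.

Lemma path_sign_rev (V : finType) (S : signed_graph V) (u : V) (p : seq V) :
  path (adj S) u p ->
  path_sign S (last u p) (rev (belast u p)) = path_sign S u p.
Proof.
elim: p u => [|v p IHp] u //= /andP[uv pP].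
rewrite rev_cons path_sign_rcons last_rev_belast IHp // path_sign_cons.
by rewrite mulrC (sgn_sym uv).
Qed.

(** * Balance makes signs depend only on endpoints *)

Lemma repeated_vertex_loop (T : eqType) (u : T) (p : seq T) :
  ~~ uniq (u :: p) ->
  exists p1 p2 p3, [/\ p = p1 ++ p2 ++ p3, (0 < size p2)%N
                     & last (last u p1) p2 = last u p1].
Proof.
elim: p u => [|v p IHp] u //; rewrite [uniq _]/= -/(uniq (v :: p)).
rewrite negb_and negbK.
case/orP=> [/splitPr[p2 p3]|/IHp[p1 [p2 [p3 [-> p2_gt0 loop]]]]].
  by exists [::], (rcons p2 u), p3; rewrite cat_rcons size_rcons last_rcons.
by exists (v :: p1), p2, p3.
Qed.

(** Strong induction on the length, cutting at a repeated vertex.  A closed walk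
    whose vertices are distinct is a cycle, or has length at most 2 and
    traverses at most one edge, back and forth. *)
Lemma balanced_closed_walk (V : finType) (S : signed_graph V) :
  balanced S -> forall (u : V) (p : seq V),
  path (adj S) u p -> last u p = u -> path_sign S u p = 1.
Proof.
move=> balS u p; have [n le_n] := ubnP (size p).
elim: n u p le_n => // n IHn u.
case/lastP=> [|p w]; first by rewrite path_sign_nil.
rewrite size_rcons ltnS last_rcons => le_n pP wu; subst w.
have [up|not_uniq] := boolP (uniq (u :: p)).
  case: p pP up le_n => [|v [|w p]] pP up _.
  - by move: pP; rewrite /= adj_irrefl.
  - move: pP; rewrite /= andbT => /andP[uv vu].
    by rewrite !path_sign_cons path_sign_nil mulr1 (sgn_sym vu) sgn_sq.
  - by apply: (balS (u :: v :: w :: p)); apply/and3P; split.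
have [p1 [p2 [p3 [pE p2_gt0 loop]]]] := repeated_vertex_loop not_uniq.
move: le_n pP; rewrite {p not_uniq}pE !rcons_cat !cat_path loop !size_cat => le_n.
case/and3P=> p1P p2P p3P; rewrite !path_sign_cat loop.
rewrite (IHn (last u p1) p2) //; last first.
  by apply: leq_trans le_n; rewrite ltnS addnCA leq_addr.
rewrite mul1r -path_sign_cat; apply: IHn.
- rewrite size_cat size_rcons addnS; apply: leq_ltn_trans le_n.
  by rewrite ltn_add2l -addn1 addnC leq_add2r.
- by rewrite cat_path p1P.
- by rewrite last_cat last_rcons.
Qed.

(** * Compatibility *)

Lemma sigma_max_sq (V : finType) (S : signed_graph V) (u v : V) :
  sigma_max S u v * sigma_max S u v = 1.
Proof. by rewrite /sigma_max; case: ifP. Qed.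

(** At distance 0 the equality of [d_min] and [d_max] says nothing about
    [sigma_min] and [sigma_max], but then the only geodesic is trivial. *)
Lemma compatible_geodesic_sign (V : finType) (S : signed_graph V) (u v : V)
    (p : seq V) :
  vertices_compatible S u v -> geodesic S u v p ->
  path_sign S u p = sigma_max S u v.
Proof.
move=> compat pG; have pP := geodesic_uv_path pG.
have /and3P[_ _ sp] := pG.
move: compat; rewrite /vertices_compatible /d_min /d_max /sigma_max.
case: ifP => [/forallP/(_ (Tuple sp))/implyP/(_ pP)/eqP //|_].
rewrite /sigma_min; case: ifP => [/forallP/(_ (Tuple sp))/implyP/(_ pP)/eqP //|_].
case: (dist S u v) sp => [|d _].
  by rewrite size_eq0 => /eqP->; rewrite path_sign_nil.
by rewrite mul1r mulN1r.
Qed.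

(** Connectivity matters: if there were no geodesic, [sigma_max] would be -1 and
    [sigma_min] would be 1, both vacuously.  With at least one geodesic and a
    common sign, both are equal to that sign. *)
Lemma compatible_of_geodesics (V : finType) (S : signed_graph V) (u v : V) :
  connect (adj S) u v ->
  (forall p q, geodesic S u v p -> geodesic S u v q ->
    path_sign S u p = path_sign S u q) ->
  vertices_compatible S u v.
Proof.
move=> /connect_geodesic[p pG] same.
have all_p (e : int) :
    [forall q : (dist S u v).-tuple V,
      uv_path S u v q ==> (path_sign S u q == e)] = (path_sign S u p == e).
  apply/forallP/idP => [all_e|/eqP <- q].
    have /and3P[_ _ sp] := pG.
    exact: (implyP (all_e (Tuple sp))) (geodesic_uv_path pG).
  apply/implyP=> /and3P[qP qv _]; rewrite (same _ p) //.
  by rewrite /geodesic qP qv size_tuple /=.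
rewrite /vertices_compatible /d_min /d_max /sigma_min /sigma_max !all_p.
have /and3P[/path_sign_sq/eqP pp _ _] := pG.
by move: pp; rewrite -expr2 sqrf_eq1 => /orP[] /eqP->.
Qed.

Lemma balanced_distance_compatible (V : finType) (S : signed_graph V) :
  connected_graph S -> balanced S -> distance_compatible S.
Proof.
move=> conS balS u v; apply: compatible_of_geodesics => // p q.
case/and3P=> pP /eqP pv _ /and3P[qP /eqP qv _].
have closed_pq : path (adj S) u (p ++ rev (belast u q)).
  rewrite cat_path pP pv -qv rev_path.
  by rewrite (eq_path (e' := adj S)) // => x y; rewrite adj_sym.
have := balanced_closed_walk balS closed_pq.
rewrite last_cat path_sign_cat pv -qv last_rev_belast path_sign_rev //.
move=> /(_ erefl) pq1.
(* Signs are their own inverses, so a product equal to 1 means equal signs. *)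
by rewrite -[LHS]mulr1 -(path_sign_sq qP) mulrA pq1 mul1r.
Qed.

(** * Compatibility gives a potential *)

Lemma bipartite_walk_parity (V : finType) (G : simple_graph V) (A : {set V}) :
  (forall u v, adj G u v -> (u \in A) != (v \in A)) ->
  forall (u : V) (p : seq V), path (adj G) u p ->
  odd (size p) = (u \in A) (+) (last u p \in A).
Proof.
move=> bipA u p; elim: p u => [|v p IHp] u /=; first by rewrite addbb.
case/andP=> /bipA uv /IHp->.
by move: uv; do 3!case: (_ \in A).
Qed.

Lemma bipartite_dist_neq (V : finType) (G : simple_graph V) (r u v : V) :
  connected_graph G -> bipartite G -> adj G u v -> dist G r u != dist G r v.
Proof.
move=> conG [A bipA] uv.
have [p /and3P[pP /eqP pu /eqP sp]] := connect_geodesic (conG r u).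
have [q /and3P[qP /eqP qv /eqP sq]] := connect_geodesic (conG r v).
apply: contra_neq (bipA u v uv) => eq_d.
apply: (@addbI (r \in A)); rewrite -{1}pu -qv.
by rewrite -!(bipartite_walk_parity bipA) // sp sq eq_d.
Qed.

(** The extended walk shows that the distance grows by at most 1 along an edge;
    as it does grow, the extension is shortest. *)
Lemma geodesic_rcons (V : finType) (G : simple_graph V) (r u v : V)
    (p : seq V) :
  geodesic G r u p -> adj G u v -> (dist G r u < dist G r v)%N ->
  geodesic G r v (rcons p v).
Proof.
case/and3P=> pP /eqP pu /eqP sp uv lt_d.
have pvP : path (adj G) r (rcons p v) by rewrite rcons_path pP pu.
rewrite /geodesic pvP last_rcons eqxx size_rcons eqn_leq sp lt_d /=.
by have := dist_le_walk pvP; rewrite last_rcons size_rcons sp.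
Qed.

(** The potential of the introduction.  Bipartiteness rules out edges between
    vertices equidistant from [r], on which geodesics give no information. *)
Lemma sgn_potential (V : finType) (S : signed_graph V) (r u v : V) :
  connected_graph S -> bipartite S -> distance_compatible S -> adj S u v ->
  sgn S u v = sigma_max S r u * sigma_max S r v.
Proof.
move=> conS bipS compS.
wlog lt_d : u v / (dist S r u < dist S r v)%N => [hwlog uv|uv].
  have vu : adj S v u by rewrite adj_sym.
  have := bipartite_dist_neq r conS bipS uv.
  by rewrite neq_ltn => /orP[] /hwlog; [|rewrite (sgn_sym uv) mulrC]; apply.
have [p pG] := connect_geodesic (conS r u).
have pvG := geodesic_rcons pG uv lt_d.
rewrite -(compatible_geodesic_sign (compS r v) pvG) path_sign_rcons.
rewrite (compatible_geodesic_sign (compS r u) pG) mulrA sigma_max_sq mul1r.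
by case/and3P: pG => _ /eqP->.
Qed.

Lemma distance_compatible_balanced (V : finType) (S : signed_graph V) :
  connected_graph S -> bipartite S -> distance_compatible S -> balanced S.
Proof.
move=> conS bipS compS [|r c] // /and3P[_ cP _].
have telescope u p : path (adj S) u p ->
    path_sign S u p = sigma_max S r u * sigma_max S r (last u p).
  elim: p u => [|v p IHp] u /=; first by rewrite path_sign_nil sigma_max_sq.
  case/andP=> uv /IHp IH; rewrite path_sign_cons IH.
  rewrite (sgn_potential r conS bipS compS uv) -mulrA.
  by rewrite (mulrA (sigma_max S r v)) sigma_max_sq mul1r.
by rewrite /= telescope // last_rcons sigma_max_sq.
Qed.

Theorem theorem5p1 (V : finType) (S : signed_graph V) :
  connected_graph S -> bipartite S -> (distance_compatible S <-> balanced S).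
Proof.
move=> conS bipS; split; first exact: distance_compatible_balanced.
exact: balanced_distance_compatible.
Qed.
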